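(* Let $m,n$ be positive integers, let $u_1,\dots,u_m\in\mathbb{R}^n$ be pairwise orthogonal unit vectors, let $b_1,\dots,b_m\in\mathbb{R}$ with $|b_i|\le R$ for all $i\in[m]$, and let $B$ be an integer with $0<B<m$ (the mini-batch size). There exists an algorithm such that, for any $\delta\in(0,1)$, it performs $\widetilde{O}(m^{3/2}B^{-1}R\delta^{-1})$ iterations of (stochastic) gradient descent, each taking $O(Bn^2)$ time, and outputs a matrix $A\in\mathbb{R}^{n\times n}$ satisfying $$|u_i^\top A u_i-b_i|\le\delta\quad\text{for all } i\in[m].$$
   Context: Approximate matrix sensing: given $(u_i,b_i)\in\mathbb{R}^n\times\mathbb{R}$, $i\in[m]$ (with $b_i=u_i^\top A_\star u_i$ for an unknown positive definite $A_\star$), find $A$ with $|u_i^\top Au_i-b_i|\le\delta$ for all $i$. The stochastic gradient descent is on the potential $\Phi_\lambda(A)=\sum_{i=1}^m\cosh(\lambda(u_i^\top Au_i-b_i))$: in each iteration a subset $\mathcal{B}_t\subset[m]$ of size $B$ is sampled uniformly, and $A_{t+1}=A_t-\epsilon\nabla\Phi_\lambda(A_t,\mathcal{B}_t)/\|\nabla\Phi_\lambda(A_t)\|_F$, where $\nabla\Phi_\lambda(A,\mathcal{B})=\frac{m}{|\mathcal{B}|}\sum_{i\in\mathcal{B}}u_iu_i^\top\lambda\sinh(\lambda(u_i^\top Au_i-b_i))$ and $\nabla\Phi_\lambda(A)=\sum_{i=1}^m u_iu_i^\top\lambda\sinh(\lambda(u_i^\top Au_i-b_i))$. $\widetilde{O}(f)$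 means $f\cdot\mathrm{poly}(\log f)$.
   Formalization: Since random batches can always miss an index, the output bound is proved with probability at least 1-m^{-k} for every fixed k (algorithm and constants depending on k), with start a multiple of I and step parameters and iteration count chosen from m, n, B, R and δ. *)

(* Defs.v *)
From HB Require Import structures.
From mathcomp Require Import all_boot all_order all_algebra.
From mathcomp Require Import reals sequences exp.

Set Implicit Arguments.
Unset Strict Implicit.
Unset Printing Implicit Defensive.

Import Order.TTheory GRing.Theory Num.Theory.
Local Open Scope ring_scope.

(** * Vectors, matrices and stochastic gradient descent *)

Definition sinh (R : realType) (x : R) : R := (expR x - expR (- x)) / 2.

Definition dot (R : realType) (n : nat) (v w : 'cV[R]_n) : R :=
  \sum_p v p 0 * w p 0.

Definition enorm (R : realType) (n : nat) (v : 'cV[R]_n) : R :=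
  Num.sqrt (dot v v).

Definition frob (R : realType) (n : nat) (A : 'M[R]_n) : R :=
  Num.sqrt (\sum_p \sum_q A p q ^+ 2).

(* u^T A u - b *)
Definition resid (R : realType) (n : nat) (u : 'cV[R]_n) (b : R) (A : 'M[R]_n)
  : R := (u^T *m A *m u) 0 0 - b.

(* Gradient in A of cosh (lam (u^T A u - b)). *)
Definition grad_term (R : realType) (n : nat) (lam : R) (u : 'cV[R]_n) (b : R)
    (A : 'M[R]_n) : 'M[R]_n :=
  (lam * sinh (lam * resid u b A)) *: (u *m u^T).

Section SGD.
Variables (R : realType) (m n : nat) (u : 'I_m -> 'cV[R]_n) (b : 'I_m -> R).

Definition grad (lam : R) (A : 'M[R]_n) : 'M[R]_n :=
  \sum_i grad_term lam (u i) (b i) A.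

Definition batch_grad (lam : R) (A : 'M[R]_n) (S : {set 'I_m}) : 'M[R]_n :=
  (m%:R / #|S|%:R) *: \sum_(i in S) grad_term lam (u i) (b i) A.

(* When the full gradient vanishes all residuals on orthonormal data are zero,
   hence so is the batch gradient: x / 0 = 0 then leaves A unchanged. *)
Definition sgd_step (lam eps : R) (A : 'M[R]_n) (S : {set 'I_m}) : 'M[R]_n :=
  A - (eps / frob (grad lam A)) *: batch_grad lam A S.

(* The iterate reached from tau I after using the batches of s in order. *)
Definition sgd (lam eps tau : R) (s : seq {set 'I_m}) : 'M[R]_n :=
  foldl (sgd_step lam eps) tau%:M s.

End SGD.

(* Step-size data: potential parameter, learning rate, multiple of the identity
   used as starting point, and number of iterations. *)
Record hyper (R : Type) := Hyper {
  h_lam : R; h_eps : R; h_tau : R; h_iters : nat }.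

(** * Random mini-batches *)

Definition batch_seqs (m B T : nat) : {set T.-tuple {set 'I_m}} :=
  [set s : T.-tuple {set 'I_m} | all (fun S : {set 'I_m} => #|S| == B) s].

(* Probability of E when the T batches are independent and each is uniform
   among the subsets of [m] of size B. *)
Definition batch_prob (R : realType) (m B T : nat)
    (E : pred (seq {set 'I_m})) : R :=
  #|[set s in batch_seqs m B T | E s]|%:R / #|batch_seqs m B T|%:R.

(** * A unit-cost real RAM

    A program manipulates finitely many named arrays of natural numbers and
    finitely many named arrays of reals; scalars are array cells.  It is a closed
    piece of syntax that does not depend on the instance.  Every loop bound is
    evaluated on entry, so every program terminates. *)

Inductive iexpr :=
| INat of nat
| IGet of nat & iexpr
| IAdd of iexpr & iexpr
| IMul of iexpr & iexpr.

Inductive rexpr :=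
| ROfNat of iexpr
| RGet of nat & iexpr
| RAdd of rexpr & rexpr
| RSub of rexpr & rexpr
| RMul of rexpr & rexpr
| RDiv of rexpr & rexpr
| RSqrt of rexpr
| RExp of rexpr.

Inductive cmd :=
| Skip
| Seq of cmd & cmd
| ISet of nat & iexpr & iexpr     (* array, index, value *)
| RSet of nat & iexpr & rexpr     (* array, index, value *)
| IfLe of rexpr & rexpr & cmd & cmd
| For of nat & iexpr & cmd.       (* counter in cell 0 of an array, bound, body *)

Record state (R : Type) := State {
  imem : nat -> nat -> nat;
  rmem : nat -> nat -> R }.

Definition upd (V : Type) (f : nat -> nat -> V) (a i : nat) (v : V) :
    nat -> nat -> V :=
  fun a' i' => if (a' == a) && (i' == i) then v else f a' i'.

Fixpoint icost (e : iexpr) : nat :=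
  match e with
  | INat _ => 1
  | IGet _ i => (icost i).+1
  | IAdd e1 e2 | IMul e1 e2 => (icost e1 + icost e2).+1
  end.

Fixpoint rcost (e : rexpr) : nat :=
  match e with
  | ROfNat i | RGet _ i => (icost i).+1
  | RAdd e1 e2 | RSub e1 e2 | RMul e1 e2 | RDiv e1 e2 =>
      (rcost e1 + rcost e2).+1
  | RSqrt e1 | RExp e1 => (rcost e1).+1
  end.

Section Semantics.
Variable R : realType.
Implicit Types st : state R.

Fixpoint ieval st (e : iexpr) : nat :=
  match e with
  | INat c => c
  | IGet a i => imem st a (ieval st i)
  | IAdd e1 e2 => (ieval st e1 + ieval st e2)%N
  | IMul e1 e2 => (ieval st e1 * ieval st e2)%N
  end.

Fixpoint reval st (e : rexpr) : R :=
  match e with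
  | ROfNat i => (ieval st i)%:R
  | RGet a i => rmem st a (ieval st i)
  | RAdd e1 e2 => reval st e1 + reval st e2
  | RSub e1 e2 => reval st e1 - reval st e2
  | RMul e1 e2 => reval st e1 * reval st e2
  | RDiv e1 e2 => reval st e1 / reval st e2
  | RSqrt e1 => Num.sqrt (reval st e1)
  | RExp e1 => expR (reval st e1)
  end.

Definition iset st a i v : state R := State (upd (imem st) a i v) (rmem st).
Definition rset st a i v : state R := State (imem st) (upd (rmem st) a i v).

(* Final state and number of elementary operations performed. *)
Fixpoint exec (c : cmd) (st : state R) : state R * nat :=
  match c with
  | Skip => (st, 1%N)
  | Seq c1 c2 =>
      let r1 := exec c1 st in
      let r2 := exec c2 r1.1 in
      (r2.1, (r1.2 + r2.2)%N)
  | ISet a i e =>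
      (iset st a (ieval st i) (ieval st e), (icost i + icost e).+1)
  | RSet a i e =>
      (rset st a (ieval st i) (reval st e), (icost i + rcost e).+1)
  | IfLe e1 e2 c1 c2 =>
      let r := exec (if reval st e1 <= reval st e2 then c1 else c2) st in
      (r.1, (rcost e1 + rcost e2 + r.2).+1)
  | For x e c0 =>
      iteri (ieval st e)
        (fun k acc =>
           let r := exec c0 (iset acc.1 x 0%N k) in
           (r.1, (acc.2 + r.2).+1))
        (st, (icost e).+1)
  end.

End Semantics.

(** * Memory layout

    Natural-number arrays: [dim_arr] holds n, m, B; [batch_arr] holds the indices
    of the current mini-batch.  Real arrays: [u_arr] holds u_i(p) at i * n + p,
    [b_arr] holds b_i at i, [par_arr] holds lambda, epsilon, tau, and [A_arr]
    holds A(p,q) at p * n + q.  Everything else is scratch space, initially 0. *)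

Definition dim_arr : nat := 0.
Definition batch_arr : nat := 1.

Definition u_arr : nat := 0.
Definition b_arr : nat := 1.
Definition par_arr : nat := 2.
Definition A_arr : nat := 3.

Section Runs.
Variables (R : realType) (m n : nat) (u : 'I_m -> 'cV[R]_n) (b : 'I_m -> R).

Definition input_imem (B : nat) : nat -> nat -> nat := fun a j =>
  if a == dim_arr then nth 0%N [:: n; m; B] j else 0%N.

Definition input_rmem (h : hyper R) : nat -> nat -> R := fun a j =>
  if a == u_arr then \sum_(i < m) \sum_(p < n | (i * n + p)%N == j) u i p 0
  else if a == b_arr then \sum_(i < m | i == j :> nat) b i
  else if a == par_arr then nth 0 [:: h_lam h; h_eps h; h_tau h] j
  else 0.

Definition input (B : nat) (h : hyper R) : state R :=
  State (input_imem B) (input_rmem h).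

Definition load_batch (S : {set 'I_m}) (st : state R) : state R :=
  State (fun a j => if a == batch_arr then nth 0%N (map val (enum S)) j
                    else imem st a j)
        (rmem st).

(* One iteration: draw a mini-batch (one operation per index), run the body. *)
Definition iteration (step : cmd) (st : state R) (S : {set 'I_m}) :
    state R * nat :=
  let r := exec step (load_batch S st) in (r.1, (#|S| + r.2)%N).

Definition run (setup step : cmd) (B : nat) (h : hyper R)
    (s : seq {set 'I_m}) : state R :=
  foldl (fun st S => (iteration step st S).1) (exec setup (input B h)).1 s.

Definition read_A (st : state R) : 'M[R]_n :=
  \matrix_(p, q) rmem st A_arr (p * n + q)%N.

End Runs.

(* Main.v *)
(** With orthonormal u_i the residuals r_i = u_i^T A u_i - b_i evolve separately:
    a step moves r_i, for i in the batch, by eps (m / B) sinh (lam r_i) / N where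
    N^2 = sum_j sinh^2 (lam r_j).  Choose eps with lam eps m / B = 1/4 and let
    Phi = sum_i cosh (lam r_i).  To second order the expected change of Phi is at
    most (B / (8 m)) (1 - N), and Phi <= m + sqrt m N by Cauchy-Schwarz, so
    Phi - (m + sqrt m) contracts in expectation by 1 - B / (8 m sqrt m).  Starting
    from A = 0, where Phi <= m exp (lam R), the expectation of Phi is at most 3 m
    after 8 m^(3/2) lam R / B steps.  A residual above delta forces
    Phi >= exp (lam delta) / 2, which for lam = (k + 4) ln m / delta is
    m^(k+4) / 2, and Markov's inequality bounds the failure probability by m^-k.
    If R <= delta, no step is needed. *)

Require Import Defs.
From mathcomp Require Import all_boot all_order all_algebra.
From mathcomp Require Import reals sequences exp.
From mathcomp Require Import ring lra zify.

Set Implicit Arguments.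
Unset Strict Implicit.
Unset Printing Implicit Defensive.

Import Order.TTheory GRing.Theory Num.Theory.
Local Open Scope ring_scope.

(** * Decrease of the potential *)

Section Cosh.
Variable R : realType.
Implicit Types x a : R.

Definition cosh x : R := (expR x + expR (- x)) / 2.

Lemma sinhN x : sinh (- x) = - sinh x.
Proof. by rewrite /sinh opprK; field. Qed.

Lemma cosh_gt0 x : 0 < cosh x.
Proof. by rewrite divr_gt0 // addr_gt0 // expR_gt0. Qed.

Lemma expR_normr_le_cosh x : expR `|x| <= 2 * cosh x.
Proof.
rewrite /cosh mulrC divfK ?pnatr_eq0 //.
by have [_|_] := ger0P x; rewrite ?lerDl ?lerDr ltW ?expR_gt0.
Qed.

Lemma cosh_le_expR_normr x : cosh x <= expR `|x|.
Proof.
have le2 : expR x <= expR `|x| by rewrite ler_expR ler_norm.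
have le1 : expR (- x) <= expR `|x| by rewrite ler_expR -normrN ler_norm.
by rewrite /cosh; lra.
Qed.

(** For [x >= 0] the gap [cosh x - sinh x] is [expR (- x)], at most 1; parity gives the rest. *)
Lemma cosh_le_sinh x : cosh x <= 1 + `|sinh x|.
Proof.
wlog x_ge0 : x / 0 <= x.
  move=> H; have [/H //|x_lt0] := leP 0 x.
  have := H (- x); rewrite oppr_ge0 ltW // sinhN normrN /cosh opprK => /(_ isT).
  by rewrite addrC.
have : expR (- x) <= 1 by rewrite -expR0 ler_expR oppr_le0.
have := ler_norm (sinh x); rewrite /cosh /sinh; lra.
Qed.

(** From [expR (- x) >= 1 - x] one gets [expR x * (1 - x) <= 1], while the quadratic times [1 - x]
    is [1 + x ^+ 2 * (1 - 2 * x)], at least 1 exactly because [x <= 1 / 2]. *)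
Lemma expR_le_quad x : x <= 1 / 2 -> expR x <= 1 + x + 2 * x ^+ 2.
Proof.
move=> x_le; have e_gt0 := expR_gt0 x.
have : expR x * expR (- x) = 1 by rewrite -expRD subrr expR0.
have := expR_ge1Dx (- x); set y := expR (- x) => y_ge xy.
have : expR x * (1 - x) <= 1 by rewrite -[leRHS]xy ler_pM2l.
move=> ex_le.
have : 1 <= (1 - x) * (1 + x + 2 * x ^+ 2).
  have -> : (1 - x) * (1 + x + 2 * x ^+ 2) = 1 + x ^+ 2 * (1 - 2 * x) by ring.
  by rewrite lerDl mulr_ge0 ?sqr_ge0 //; lra.
move=> /(le_trans ex_le); rewrite mulrC ler_pM2l //; lra.
Qed.

Lemma cosh_sub_le a x : `|x| <= 1 / 2 ->
  cosh (a - x) <= cosh a + (2 * x ^+ 2 * cosh a - x * sinh a).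
Proof.
rewrite ler_norml => /andP[x_ge x_le].
have e1 : expR (a - x) <= expR a * (1 - x + 2 * x ^+ 2).
  rewrite expRD ler_pM2l ?expR_gt0 // -(sqrrN x) expR_le_quad //; lra.
have e2 : expR (- (a - x)) <= expR (- a) * (1 + x + 2 * x ^+ 2).
  by rewrite opprB addrC expRD ler_pM2l ?expR_gt0 // expR_le_quad.
rewrite /cosh /sinh; apply: (@le_trans _ _
  ((expR a * (1 - x + 2 * x ^+ 2) + expR (- a) * (1 + x + 2 * x ^+ 2)) / 2)).
  by rewrite ler_pM2r ?lerD // invr_gt0.
lra.
Qed.

End Cosh.

(** * Counting the subsets of given size through a point *)

Section Sets.
Variable T : finType.

(* Removing x maps these sets bijectively onto the k.-1-subsets avoiding x. *)
Lemma card_draws_mem (k : nat) (x : T) :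
  (#|T| * #|[set S : {set T} | (#|S| == k) && (x \in S)]| = k * 'C(#|T|, k))%N.
Proof.
case: k => [|k].
  rewrite mul0n; apply/eqP; rewrite muln_eq0 cards_eq0; apply/orP; right.
  apply/eqP/setP => S; rewrite !inE; apply/negP => /andP[/eqP/cards0_eq ->].
  by rewrite inE.
rewrite -mul_bin_diag; congr (_ * _)%N.
have -> : #|T|.-1 = #|[set~ x]| by rewrite cardsC1.
rewrite -cards_draws -[RHS](@card_in_imset _ _ (fun S : {set T} => x |: S)); last first.
  move=> S1 S2; rewrite !inE => /andP[s1 _] /andP[s2 _] e12.
  have nx (S : {set T}) : S \subset [set~ x] -> S = (x |: S) :\ x.
    move=> /subsetP sS; apply/setP => y; rewrite !inE.
    have [->|//] := eqVneq y x; by apply/negP => /sS; rewrite !inE eqxx.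
  by rewrite (nx _ s1) e12 -nx.
congr #|pred_of_set _|; apply/setP => S; rewrite !inE; apply/andP/imsetP.
  move=> [/eqP cS xS]; exists (S :\ x); last by rewrite setD1K.
  move: cS; rewrite (cardsD1 x S) xS add1n => -[cS]; rewrite inE cS eqxx andbT.
  by apply/subsetP => y; rewrite !inE => /andP[].
move=> [S' +  ->]; rewrite inE => /andP[/subsetP sS /eqP cS].
have xS' : x \notin S' by apply/negP => /sS; rewrite !inE eqxx.
by rewrite cardsU1 xS' cS setU11.
Qed.

End Sets.

(** * Expected change of the potential in one step *)

Section Drift.
Variables (R : realType) (m : nat).
Implicit Types a : 'I_m -> R.

(** On orthonormal data this is the Frobenius norm of the full gradient divided by [lam]; see
    [frob_grad]. *)
Definition sinh_norm a : R := Num.sqrt (\sum_i sinh (a i) ^+ 2).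

Definition potential a : R := \sum_i cosh (a i).

Lemma sqr_sinh_norm a : sinh_norm a ^+ 2 = \sum_i sinh (a i) ^+ 2.
Proof. by rewrite sqr_sqrtr // sumr_ge0 // => i _; rewrite sqr_ge0. Qed.

Lemma sinh_norm_ge a i : `|sinh (a i)| <= sinh_norm a.
Proof.
rewrite -sqrtr_sqr ler_wsqrtr // (bigD1 i) //= lerDl sumr_ge0 // => j _.
by rewrite sqr_ge0.
Qed.

Lemma sinh_norm_ge0 a : 0 <= sinh_norm a.
Proof. exact: sqrtr_ge0. Qed.

Lemma sum_sinh_le a : \sum_i `|sinh (a i)| <= Num.sqrt m%:R * sinh_norm a.
Proof.
have := sinh_norm_ge0 a; rewrite le_eqVlt => /orP[/eqP N0|N_gt0].
  by rewrite -N0 mulr0 big1 // => i _; apply/le_anti; rewrite normr_ge0 N0 sinh_norm_ge.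
case: (posnP m) => [m0|m_gt0].
  by rewrite big1 ?mulr_ge0 ?sqrtr_ge0 // => i _; have := ltn_ord i; rewrite {2}m0.
set s := Num.sqrt _; have s_gt0 : 0 < s by rewrite sqrtr_gt0 ltr0n.
have ss : s ^+ 2 = m%:R by rewrite sqr_sqrtr ?ler0n.
(* Cauchy-Schwarz by weighted AM-GM in each term: with these weights both halves of the summed bound
   equal [s * N / 2], where [N] is [sinh_norm a]. *)
have amgm i : `|sinh (a i)| <= (s / sinh_norm a * sinh (a i) ^+ 2 + sinh_norm a / s) / 2.
  rewrite -[sinh (a i) ^+ 2]real_normK ?num_real //.
  set N := sinh_norm a in N_gt0 *; set t := `|_|.
  have Ngt : N != 0 by rewrite gt_eqF. have sgt : s != 0 by rewrite gt_eqF.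
  rewrite -subr_ge0 (_ : _ - _ = (s * t - N) ^+ 2 / (2 * s * N)).
    by rewrite divr_ge0 ?sqr_ge0 // !mulr_ge0 // ltW.
  by field; rewrite Ngt.
apply: le_trans (ler_sum _ (fun i _ => amgm i)) _.
rewrite -mulr_suml big_split /= -mulr_sumr -sqr_sinh_norm sumr_const card_ord.
rewrite -[_ / s *+ m]mulr_natr -ss le_eqVlt; apply/orP; left; apply/eqP.
by field; rewrite !gt_eqF.
Qed.

Lemma potential_le a : potential a <= m%:R + Num.sqrt m%:R * sinh_norm a.
Proof.
apply: (@le_trans _ _ (\sum_i (1 + `|sinh (a i)|))).
  by apply: ler_sum => i _; exact: cosh_le_sinh.
by rewrite big_split /= sumr_const card_ord lerD2l sum_sinh_le.
Qed.

(** Effect of one step on the residuals multiplied by [lam]; the factor 1/4 is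
    [lam * eps * m / B]. *)
Definition descent a (S : {set 'I_m}) (i : 'I_m) : R :=
  a i - (i \in S)%:R * (4^-1 * sinh (a i) / sinh_norm a).

(** The level of the potential above which the bound on its expected change is negative. *)
Definition equilibrium : R := m%:R + Num.sqrt m%:R.

Definition contraction (B : nat) : R := B%:R / (8 * m%:R * Num.sqrt m%:R).

(** The expectation is left unnormalised, as a sum over all ['C(m, B)] batches. After the
    second-order bound the change is linear in the indicators of [i \in S], and each index lies in a
    fraction [B / m] of the batches. *)
Lemma descent_drift a (B : nat) : (0 < m)%N ->
  \sum_(S : {set 'I_m} | #|S| == B) (potential (descent a S) - equilibrium)
  <= 'C(m, B)%:R * ((1 - contraction B) * (potential a - equilibrium)).
Proof.
move=> m_gt0; set N := sinh_norm a; have N_ge0 : 0 <= N := sinh_norm_ge0 a.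
pose x i := 4^-1 * sinh (a i) / N.
pose d i := 2 * x i ^+ 2 * cosh (a i) - x i * sinh (a i).
(* Dividing by [N] keeps each move within 1/4, inside the range of [cosh_sub_le]; if [N] is 0 the
   move is 0. *)
have x_le i : `|x i| <= 1 / 2.
  rewrite /x normrM normfV (ger0_norm N_ge0) normrM (@ger0_norm _ (4^-1)) ?invr_ge0 //.
  have := N_ge0; rewrite le_eqVlt => /orP[/eqP<-|N_gt0]; first by rewrite invr0 mulr0 divr_ge0.
  rewrite ler_pdivrMr //; have := sinh_norm_ge a i; rewrite -/N; lra.
have sum_x2 : \sum_i x i ^+ 2 <= 16^-1.
  under eq_bigr do rewrite /x 2!exprMn mulrAC.
  rewrite -mulr_sumr -sqr_sinh_norm -/N.
  have [->|N0] := eqVneq N 0; first by rewrite expr0n mulr0 invr_ge0.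
  by rewrite -mulrA -exprMn mulVf // expr1n; lra.
have sum_xs : \sum_i x i * sinh (a i) = 4^-1 * N.
  under eq_bigr do rewrite /x mulrAC -(mulrA 4^-1) -expr2 mulrAC.
  rewrite -mulr_sumr -sqr_sinh_norm -/N.
  have [->|N0] := eqVneq N 0; first by rewrite expr0n !mulr0.
  by field.
(* Since [cosh (a i) <= 1 + N], the second-order part is at most [(1 + N) / 8], against a
   first-order gain of [N / 4]. *)
have sum_d : \sum_i d i <= 8^-1 * (1 - N).
  rewrite /d big_split /= sumrN sum_xs.
  apply: (@le_trans _ _ (2 * (1 + N) * \sum_i x i ^+ 2 - 4^-1 * N)).
    rewrite lerD2r mulr_sumr; apply: ler_sum => i _.
    rewrite [leLHS]mulrAC ler_wpM2r ?sqr_ge0 // ler_pM2l //.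
    by rewrite (le_trans (cosh_le_sinh _)) // lerD2l sinh_norm_ge.
  have := ler_wpM2l (_ : 0 <= 2 * (1 + N)) sum_x2; rewrite mulr_ge0 ?addr_ge0 //.
  by move=> /(_ isT); lra.
have mR_gt0 : 0 < m%:R :> R by rewrite ltr0n.
have count i : \sum_(S : {set 'I_m} | #|S| == B) (i \in S)%:R = 'C(m, B)%:R * (B%:R / m%:R) :> R.
  under eq_bigr do rewrite mulrb.
  rewrite -big_mkcondr sumr_const -cardsE; apply: (mulfI (lt0r_neq0 mR_gt0)).
  have := card_draws_mem B i; rewrite card_ord -natrM => ->.
  by rewrite natrM; field; rewrite gt_eqF.
apply: (@le_trans _ _ ('C(m, B)%:R * (potential a - equilibrium + B%:R / m%:R * \sum_i d i))).
  apply: (@le_trans _ _ (\sum_(S : {set 'I_m} | #|S| == B)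
      ((potential a - equilibrium) + \sum_i (i \in S)%:R * d i))).
    apply: ler_sum => S _; rewrite addrAC lerD2r -big_split /=.
    apply: ler_sum => i _; rewrite /descent.
    case: (i \in S); last by rewrite mulr0n !mul0r subr0 addr0.
    by rewrite mulr1n !mul1r; apply: cosh_sub_le; exact: x_le.
  rewrite big_split /= sumr_const exchange_big /=.
  under [X in _ + X <= _]eq_bigr do rewrite -mulr_suml count.
  rewrite -mulr_sumr [leRHS]mulrDr -[X in _ + X <= _]mulrA lerD2r.
  by rewrite -cardsE card_draws card_ord mulr_natl.
rewrite ler_wpM2l //.
have s_gt0 : 0 < Num.sqrt m%:R :> R by rewrite sqrtr_gt0.
have drift : \sum_i d i <= 8^-1 * ((equilibrium - potential a) / Num.sqrt m%:R).
  apply: (le_trans sum_d); rewrite ler_pM2l ?invr_gt0 // (ler_pdivlMr _ _ s_gt0) /equilibrium.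
  by have := potential_le a; rewrite -/N; lra.
apply: (@le_trans _ _ (potential a - equilibrium +
    B%:R / m%:R * (8^-1 * ((equilibrium - potential a) / Num.sqrt m%:R)))).
  by rewrite lerD2l ler_wpM2l // divr_ge0.
rewrite le_eqVlt; apply/orP; left; apply/eqP; rewrite /contraction.
by field; rewrite !gt_eqF.
Qed.

End Drift.

(** * Gradient descent on orthonormal data *)

Section QuadraticForms.
Variables (R : realType) (n : nat).
Implicit Types (u v : 'cV[R]_n) (A : 'M[R]_n).

Definition quad u A : R := (u^T *m A *m u) 0 0.

Lemma quadE u A : quad u A = \sum_p \sum_q A p q * (u p 0 * u q 0).
Proof.
rewrite /quad mxE exchange_big /=; apply: eq_bigr => q _.
rewrite !mxE mulr_suml; apply: eq_bigr => p _; rewrite mxE; ring.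
Qed.

Lemma quadB u A1 A2 : quad u (A1 - A2) = quad u A1 - quad u A2.
Proof. by rewrite /quad mulmxBr mulmxBl !mxE. Qed.

Lemma quadZ u c A : quad u (c *: A) = c * quad u A.
Proof. by rewrite /quad -scalemxAr -scalemxAl mxE. Qed.

Lemma quad0 u : quad u 0 = 0.
Proof. by rewrite -(scale0r 0) quadZ mul0r. Qed.

Lemma quad_sum (I : finType) (P : pred I) u (F : I -> 'M[R]_n) :
  quad u (\sum_(i | P i) F i) = \sum_(i | P i) quad u (F i).
Proof. by rewrite /quad mulmx_sumr mulmx_suml summxE. Qed.

Lemma quad_outer u v : quad u (v *m v^T) = dot u v ^+ 2.
Proof.
rewrite /quad mulmxA -mulmxA mxE big_ord1 expr2; congr (_ * _).
  by rewrite mxE; apply: eq_bigr => p _; rewrite mxE.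
by rewrite mxE; apply: eq_bigr => p _; rewrite mxE mulrC.
Qed.

Lemma residE u c A : resid u c A = quad u A - c.
Proof. by []. Qed.

End QuadraticForms.

(** * A descent step in terms of the residuals *)

Section OrthonormalSGD.
Variables (R : realType) (m n : nat) (u : 'I_m -> 'cV[R]_n) (b : 'I_m -> R).
Hypothesis u_orthonormal : forall i j, dot (u i) (u j) = (i == j)%:R.

Lemma quad_outer_orthonormal i j : quad (u i) (u j *m (u j)^T) = (i == j)%:R.
Proof. by rewrite quad_outer u_orthonormal; case: eqP; rewrite ?expr1n ?expr0n. Qed.

Lemma quad_orthonormal_sum (P : pred 'I_m) (c : 'I_m -> R) i :
  quad (u i) (\sum_(j | P j) c j *: (u j *m (u j)^T)) = (P i)%:R * c i.
Proof.
rewrite quad_sum big_mkcond (bigD1 i) //= big1 => [|j ij].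
  by rewrite quadZ quad_outer_orthonormal eqxx addr0 mulr1; case: ifP; rewrite ?mul1r ?mul0r.
by rewrite quadZ quad_outer_orthonormal eq_sym (negPf ij) mulr0 if_same.
Qed.

(** The matrices [u j *m (u j)^T] are orthonormal for the Frobenius inner product: pairing [G] with
    the [j]-th one gives [quad (u j) G], which is the coefficient [c j]. *)
Lemma frob_orthonormal_sum (c : 'I_m -> R) :
  frob (\sum_j c j *: (u j *m (u j)^T)) = Num.sqrt (\sum_j c j ^+ 2).
Proof.
congr Num.sqrt; set G := \sum_j c j *: _.
transitivity (\sum_j c j * quad (u j) G); last first.
  by apply: eq_bigr => j _; rewrite (quad_orthonormal_sum predT) mul1r expr2.
under [RHS]eq_bigr do rewrite quadE mulr_sumr.
rewrite [RHS]exchange_big /=; apply: eq_bigr => p _.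
under [RHS]eq_bigr do rewrite mulr_sumr.
rewrite [RHS]exchange_big /=; apply: eq_bigr => q _.
rewrite expr2 {2}/G summxE mulr_sumr; apply: eq_bigr => j _.
by rewrite !mxE big_ord1 mxE; ring.
Qed.

Definition scaled_resid lam (A : 'M[R]_n) i : R := lam * resid (u i) (b i) A.

Lemma frob_grad lam A : 0 <= lam ->
  frob (grad u b lam A) = lam * sinh_norm (scaled_resid lam A).
Proof.
move=> lam_ge0; rewrite frob_orthonormal_sum.
under eq_bigr do rewrite exprMn.
by rewrite -mulr_sumr sqrtrM ?sqr_ge0 // sqrtr_sqr ger0_norm.
Qed.

Lemma scaled_resid_sgd_step (B : nat) lam A (S : {set 'I_m}) i :
  0 < lam -> (0 < m)%N -> (0 < B)%N -> #|S| = B ->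
  scaled_resid lam (sgd_step u b lam (B%:R / (4 * m%:R * lam)) A S) i
  = descent (scaled_resid lam A) S i.
Proof.
move=> lam_gt0 m_gt0 B_gt0 cS; rewrite /descent.
set s := sinh _; set N := sinh_norm _.
rewrite /scaled_resid !residE quadB !quadZ (quad_orthonormal_sum (mem S)).
rewrite frob_grad ?ltW // cS -/N -/(scaled_resid lam A i) -/s /=.
rewrite [in RHS]/scaled_resid residE.
(* With a zero gradient norm both sides divide by zero, so neither moves the residual. *)
have [->|N0] := eqVneq N 0; first by rewrite !mulr0 invr0 !(mulr0, mul0r) !subr0.
by field; rewrite N0 !pnatr_eq0 -!lt0n m_gt0 B_gt0 gt_eqF.
Qed.

End OrthonormalSGD.

(** * Sums and probabilities over batch sequences *)

Section BatchSequences.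
Variables (m B : nat).

Lemma sum_batch_seqsS (V : nmodType) T (F : seq {set 'I_m} -> V) :
  \sum_(s in batch_seqs m B T.+1) F s =
  \sum_(S : {set 'I_m} | #|S| == B) \sum_(s in batch_seqs m B T) F (S :: s).
Proof.
rewrite pair_big_dep /=.
rewrite (reindex (fun x : {set 'I_m} * T.-tuple {set 'I_m} => cons_tuple x.1 x.2)) /=.
  by apply: eq_bigl => -[S s]; rewrite !inE.
exists (fun s => (thead s, behead_tuple s)) => [[S s] _|s _].
  by congr (_, _); apply: val_inj.
by rewrite [s in RHS]tuple_eta; apply: val_inj.
Qed.

Lemma sum_batch_seqs0 (V : nmodType) (F : seq {set 'I_m} -> V) :
  \sum_(s in batch_seqs m B 0) F s = F [::].
Proof.
rewrite (big_pred1 [tuple]) // => s; rewrite inE tuple0 /=.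
by apply/esym/eqP/val_inj.
Qed.

Lemma card_batch_seqs T : #|batch_seqs m B T| = ('C(m, B) ^ T)%N.
Proof.
apply/eqP; rewrite -(eqr_nat rat) natrX; elim: T => [|T IH].
  by rewrite -sum1_card natr_sum (sum_batch_seqs0 (fun=> 1%:R : rat)).
rewrite -sum1_card natr_sum (sum_batch_seqsS _ (fun=> 1%:R : rat)) /=.
under eq_bigr do rewrite -natr_sum sum1_card (eqP IH).
by rewrite sumr_const -cardsE card_draws card_ord exprS mulr_natl.
Qed.

Variable R : realType.

(** Iterated conditional expectation, unnormalised: [q] includes the number of batches. No sign is
    assumed for [h], since the potential minus its equilibrium may be negative. *)
Lemma sum_foldl_batch_seqs (X : Type) (step : X -> {set 'I_m} -> X) (h : X -> R)
    (q : R) T x : 0 <= q ->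
  (forall x, \sum_(S : {set 'I_m} | #|S| == B) h (step x S) <= q * h x) ->
  \sum_(s in batch_seqs m B T) h (foldl step x s) <= q ^+ T * h x.
Proof.
move=> q_ge0 h_step; elim: T x => [|T IH] x.
  by rewrite (sum_batch_seqs0 (fun s => h (foldl step x s))) mul1r.
rewrite (sum_batch_seqsS _ (fun s => h (foldl step x s))) /=.
apply: (@le_trans _ _ (\sum_(S : {set 'I_m} | #|S| == B) q ^+ T * h (step x S))).
  by apply: ler_sum => S _.
by rewrite -mulr_sumr exprSr -mulrA ler_wpM2l ?exprn_ge0.
Qed.

(** Markov's inequality by counting: every failing sequence contributes at least [M] to a sum whose
    mean is at most [c]. [B <= m] makes the denominator nonzero. *)
Lemma markov_batch_prob T (E : pred (seq {set 'I_m})) (h : seq {set 'I_m} -> R) (M c : R) :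
  (B <= m)%N -> 0 < M ->
  (forall s, 0 <= h s) ->
  (forall s, s \in batch_seqs m B T -> ~~ E s -> M <= h s) ->
  \sum_(s in batch_seqs m B T) h s <= #|batch_seqs m B T|%:R * c ->
  1 - c / M <= batch_prob R B T E.
Proof.
move=> leBm M_gt0 h_ge0 h_fail h_sum.
have N_gt0 : 0 < #|batch_seqs m B T|%:R :> R.
  by rewrite ltr0n card_batch_seqs expn_gt0 bin_gt0 leBm.
rewrite /batch_prob; set good := [set s in batch_seqs m B T | E s].
pose bad := [set s in batch_seqs m B T | ~~ E s].
have split_card : #|batch_seqs m B T|%:R = #|good|%:R + #|bad|%:R :> R.
  rewrite -natrD -(cardsID [set s : T.-tuple _ | E s]); congr (_ + _)%:R; apply: eq_card => s.
    by rewrite !inE.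
  by rewrite !inE andbC.
have bad_le : #|bad|%:R <= #|batch_seqs m B T|%:R * c / M.
  rewrite ler_pdivlMr //; apply: le_trans h_sum.
  rewrite mulr_natl -sumr_const; apply: (@le_trans _ _ (\sum_(s in bad) h s)).
    by apply: ler_sum => s; rewrite inE => /andP[]; exact: h_fail.
  rewrite [leRHS](bigID (fun s : T.-tuple _ => E s)) /= addrC.
  rewrite (eq_bigl (fun s => (s \in batch_seqs m B T) && ~~ E s)) => [|s]; last by rewrite inE.
  by rewrite lerDl sumr_ge0.
rewrite ler_pdivlMr // mulrBl mul1r lerBlDr.
rewrite [in X in X <= _]split_card lerD2l (le_trans bad_le) //.
by rewrite -mulrA mulrC.
Qed.

End BatchSequences.

(** * Choice of parameters *)

Section Tuning.
Variables (R : realType) (k : nat).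

Definition tuned_lam (m : nat) (delta : R) : R := (k + 4)%:R * ln m%:R / delta.

(** The case [rad <= delta] must cost no iteration: the promised bound vanishes when [rad = 0].
    Otherwise the successor of [truncn] rounds the real step count up. *)
Definition tuned_hyper (m n B : nat) (rad delta : R) : hyper R :=
  Hyper (tuned_lam m delta) (B%:R / (4 * m%:R * tuned_lam m delta)) 0
    (if rad <= delta then 0%N
     else (Num.truncn (8 * m%:R * Num.sqrt m%:R * tuned_lam m delta * rad / B%:R)).+1).

(* Nonnegative everywhere, because ln f can be very negative when rad < delta. *)
Definition polylog : {poly R} := (16 * (k + 4))%:R *: ('X ^+ 2 + 1) + 1.

Lemma horner_polylog x : polylog.[x] = 16 * (k + 4)%:R * (x ^+ 2 + 1) + 1.
Proof. by rewrite /polylog !hornerE natrM. Qed.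

Lemma polylog_ge0 x : 0 <= polylog.[x].
Proof.
by rewrite horner_polylog addr_ge0 // mulr_ge0 ?mulr_ge0 // addr_ge0 ?sqr_ge0.
Qed.

Lemma tuned_lam_gt0 m delta : (1 < m)%N -> 0 < delta -> 0 < tuned_lam m delta.
Proof.
move=> m_gt1 delta_gt0; rewrite divr_gt0 // mulr_gt0 ?ltr0n ?addn_gt0 ?orbT //.
by rewrite ln_gt0 // ltr1n.
Qed.

Lemma powR32 (m : nat) : m%:R `^ (3 / 2) = m%:R * Num.sqrt m%:R :> R.
Proof.
case: m => [|m]; first by rewrite mul0r powR0 // gt_eqF // divr_gt0.
rewrite -powR12_sqrt // (_ : 3 / 2 = 1 + 2^-1 :> R); last by field.
by rewrite powRD ?powRr1 // pnatr_eq0 implybT.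
Qed.

(** When [rad > delta], [f] is [sqrt m] times two factors at least 1, so [ln m <= 2 * ln f]. The
    unrounded count is [8 * (k + 4) * ln m * f], and [f > 1] absorbs the rounding. *)
Lemma tuned_iters_le m n B rad delta
    (f := m%:R `^ (3 / 2) * B%:R^-1 * rad * delta^-1) :
  (0 < B < m)%N -> 0 < delta -> 0 <= rad ->
  (h_iters (tuned_hyper m n B rad delta))%:R <= f * polylog.[ln f].
Proof.
move=> /andP[B_gt0 B_lt] delta_gt0 rad_ge0.
have m_gt1 : (1 < m)%N by exact: leq_ltn_trans B_lt.
have f_ge0 : 0 <= f by rewrite /f !mulr_ge0 ?invr_ge0 ?powR_ge0 // ltW.
rewrite /=; case: (leP rad delta) => [_|rad_gt]; first by rewrite mulr_ge0 ?polylog_ge0.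
have BR_gt0 : 0 < B%:R :> R by rewrite ltr0n.
have mR_gt1 : 1 < m%:R :> R by rewrite ltr1n.
have s_gt1 : 1 < Num.sqrt m%:R :> R by rewrite -[ltLHS]sqrtr1 ltr_sqrt ?(lt_trans ltr01).
have s_le_f : Num.sqrt m%:R <= f.
  rewrite /f powR32 -!mulrA [_ * (_ * _)]mulrCA ler_peMr ?sqrtr_ge0 //.
  rewrite [X in _ <= X](_ : _ = (m%:R / B%:R) * (rad / delta)); last by ring.
  by apply: mulr_ege1; rewrite ler_pdivlMr // mul1r ?ler_nat; [exact: ltnW | exact: ltW].
have f_gt1 : 1 < f by exact: lt_le_trans s_le_f.
have ln_m : ln m%:R <= 2 * ln f.
  rewrite -[m%:R]sqr_sqrtr ?ler0n // expr2 lnM ?posrE ?(lt_trans ltr01 s_gt1) //.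
  rewrite [leLHS](_ : _ = 2 * ln (Num.sqrt m%:R)); last by ring.
  rewrite ler_pM2l // ler_ln ?posrE ?(lt_trans ltr01) //.
set y := 8 * _ * _ * _ * _ / _.
have y_eq : y = 8 * (k + 4)%:R * ln m%:R * f.
  by rewrite /y /f powR32 /tuned_lam; field; rewrite !gt_eqF.
have k_gt0 : 0 < (k + 4)%:R :> R by rewrite ltr0n addn_gt0 orbT.
have y_ge0 : 0 <= y.
  by rewrite y_eq mulr_ge0 // mulr_ge0 ?mulr_ge0 ?ln_ge0 // ltW.
have T_le : (Num.truncn y).+1%:R <= y + 1.
  by have /andP[h _] := truncn_itv y_ge0; rewrite -natr1 lerD2r.
apply: (le_trans T_le); set L := ln f in ln_m *.
apply: (@le_trans _ _ (f * (8 * (k + 4)%:R * (2 * L) + 1))).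
  rewrite y_eq mulrDr mulr1; apply: lerD; last exact: ltW.
  rewrite mulrC ler_wpM2l // ler_wpM2l //.
  by rewrite mulr_ge0 // ltW.
rewrite ler_wpM2l // horner_polylog lerD2r.
have : L <= L ^+ 2 + 1 by have := sqr_ge0 (L - 2^-1); lra.
rewrite -(ler_pM2l k_gt0); lra.
Qed.

End Tuning.

(** * Success probability of the tuned descent *)

Section SuccessProbability.
Variables (R : realType) (k m n B : nat) (u : 'I_m -> 'cV[R]_n) (b : 'I_m -> R).
Variables (rad delta : R).
Hypothesis u_orthonormal : forall i j, dot (u i) (u j) = (i == j)%:R.
Hypothesis b_le : forall i, `|b i| <= rad.
Hypotheses (B_gt0 : (0 < B)%N) (B_lt : (B < m)%N) (delta_gt0 : 0 < delta).

Let h := tuned_hyper k m n B rad delta.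

Definition sgd_success (s : seq {set 'I_m}) : bool :=
  [forall i, `|resid (u i) (b i) (sgd u b (h_lam h) (h_eps h) (h_tau h) s)| <= delta].

Let m_gt1 : (1 < m)%N. Proof. exact: leq_ltn_trans B_lt. Qed.

Let mR_gt1 : 1 < m%:R :> R. Proof. by rewrite ltr1n m_gt1. Qed.
Let mR_gt0 : 0 < m%:R :> R. Proof. by rewrite ltr0n ltnW ?m_gt1. Qed.

Let sqrt_m_gt1 : 1 < Num.sqrt m%:R :> R.
Proof. by rewrite -[ltLHS]sqrtr1 ltr_sqrt. Qed.

Lemma contraction_ge0_le1 : 0 <= contraction R m B <= 1.
Proof.
have den_gt0 : 0 < 8 * m%:R * Num.sqrt m%:R :> R.
  by rewrite !mulr_gt0 // (lt_trans ltr01 sqrt_m_gt1).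
rewrite /contraction; apply/andP; split; first by rewrite divr_ge0 // ltW.
rewrite ler_pdivrMr // mul1r.
have B_le : B%:R <= m%:R :> R by rewrite ler_nat ltnW.
rewrite (le_trans B_le) // -mulrA mulrCA ler_peMr ?(ltW mR_gt0) //.
by have := sqrt_m_gt1; lra.
Qed.

Let lam := tuned_lam k m delta.
Let lam_gt0 : 0 < lam := tuned_lam_gt0 k m_gt1 delta_gt0.

Lemma expR_tuned_lam : expR (lam * delta) = m%:R ^+ (k + 4).
Proof. by rewrite divfK ?gt_eqF // expRM_natl lnK. Qed.

Lemma potential_start :
  potential (scaled_resid u b lam 0%:M) <= m%:R * expR (lam * rad).
Proof.
apply: (@le_trans _ _ (\sum_(i < m) expR (lam * rad))).
  apply: ler_sum => i _; apply: le_trans (cosh_le_expR_normr _) _.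
  rewrite ler_expR /scaled_resid residE raddf0 quad0 sub0r normrM normrN.
  by rewrite gtr0_norm // ler_pM2l.
by rewrite sumr_const card_ord mulr_natl.
Qed.

(** The contraction over [T] steps is at most [expR (- (lam * rad))], which cancels the exponential
    in the initial potential and leaves [m]; the equilibrium adds at most [2 * m]. *)
Lemma expected_potential (T : nat) : lam * rad <= contraction R m B * T%:R ->
  \sum_(s in batch_seqs m B T)
    potential (scaled_resid u b lam (sgd u b lam (h_eps h) 0 s))
  <= #|batch_seqs m B T|%:R * (3 * m%:R).
Proof.
move=> T_ge; have /andP[c_ge0 c_le1] := contraction_ge0_le1.
set E := equilibrium R m; set q := 1 - contraction R m B.
have q_ge0 : 0 <= q by rewrite subr_ge0.
have step (A : 'M[R]_n) :
    \sum_(S : {set 'I_m} | #|S| == B)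
      (potential (scaled_resid u b lam (sgd_step u b lam (h_eps h) A S)) - E)
    <= ('C(m, B)%:R * q) * (potential (scaled_resid u b lam A) - E).
  rewrite -mulrA; apply: le_trans (descent_drift _ _ (ltnW m_gt1)).
  apply: ler_sum => S /eqP cS; rewrite lerD2r le_eqVlt; apply/orP; left; apply/eqP.
  apply: eq_bigr => i _; congr cosh.
  by rewrite scaled_resid_sgd_step // ltnW ?m_gt1.
have := sum_foldl_batch_seqs T 0%:M (_ : 0 <= 'C(m, B)%:R * q) step.
rewrite mulr_ge0 // => /(_ isT); rewrite sumrB sumr_const => sum_le.
have E_le : E <= 2 * m%:R.
  have : Num.sqrt m%:R <= m%:R :> R.
    by rewrite -[leRHS]sqr_sqrtr ?ler0n // expr2 ler_peMr ?sqrtr_ge0 // ltW.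
  by rewrite /E /equilibrium; lra.
have E_ge0 : 0 <= E by rewrite addr_ge0 ?sqrtr_ge0.
have qT_le : q ^+ T <= expR (- (lam * rad)).
  apply: (@le_trans _ _ (expR (- (contraction R m B * T%:R)))); last first.
    by rewrite ler_expR lerN2.
  rewrite -mulNr mulrC expRM_natl lerXn2r ?nnegrE ?expR_ge0 //.
  exact: expR_ge1Dx.
have start_le : q ^+ T * potential (scaled_resid u b lam 0%:M) <= m%:R.
  apply: (@le_trans _ _ (expR (- (lam * rad)) * (m%:R * expR (lam * rad)))).
    apply: ler_pM => //; rewrite ?exprn_ge0 //; last exact: potential_start.
    by apply: sumr_ge0 => i _; rewrite ltW ?cosh_gt0.
  by rewrite mulrCA -expRD addNr expR0 mulr1.
have qTE_ge0 : 0 <= q ^+ T * E by rewrite mulr_ge0 ?exprn_ge0.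
rewrite lerBlDr in sum_le; apply: (le_trans sum_le).
rewrite -[E *+ _]mulr_natl card_batch_seqs natrX exprMn -mulrA -mulrDr.
rewrite ler_wpM2l ?exprn_ge0 // mulrBr; lra.
Qed.

Lemma sgd_success_prob : 1 - m%:R ^- k <= batch_prob R B (h_iters h) sgd_success.
Proof.
have mk_ge0 : 0 <= m%:R ^- k :> R by rewrite invr_ge0 exprn_ge0.
have [rad_le|rad_gt] := leP rad delta.
  apply: (@le_trans _ _ (1 - 0 / 1)); first by rewrite mul0r lerD2l lerN2.
  (* Markov with the zero function says that no sequence fails: the only one is empty, and the zero
     matrix has residuals [- b i]. *)
  apply: (@markov_batch_prob _ _ _ _ _ (fun=> 0)) => //; first exact: ltnW.
    move=> s _ /negP[]; apply/forallP => i.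
    have -> : val s = [::] by apply/size0nil; rewrite size_tuple /h /= rad_le.
    by rewrite residE /sgd /= raddf0 quad0 sub0r normrN (le_trans (b_le i)).
  by rewrite mulr0 big1.
apply: (@le_trans _ _ (1 - 3 * m%:R / (expR (lam * delta) / 2))).
  rewrite lerD2l lerN2 ler_pdivrMr ?divr_gt0 ?expR_gt0 // expR_tuned_lam exprD.
  rewrite !mulrA mulVf ?expf_neq0 ?gt_eqF // mul1r.
  (* What remains is [3 * m <= m ^ 4 / 2], for which [m ^ 3 >= 8] suffices: hence the 4 in
     [tuned_lam]. *)
  have : 2 <= m%:R :> R by rewrite ler_nat m_gt1.
  move=> m_ge2; have : 8 <= m%:R ^+ 3 :> R.
    by rewrite (_ : 8 = 2 ^+ 3) ?lerXn2r ?nnegrE //; ring.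
  rewrite -(ler_pM2l mR_gt0); lra.
apply: (@markov_batch_prob _ _ _ _ _
  (fun s => potential (scaled_resid u b lam (sgd u b lam (h_eps h) 0 s)))).
- exact: ltnW.
- by rewrite divr_gt0 ?expR_gt0.
- by move=> s; apply: sumr_ge0 => i _; rewrite ltW ?cosh_gt0.
- move=> s _ /forallPn[i]; rewrite -ltNge => fail.
  rewrite ler_pdivrMr // [leRHS]mulrC.
  apply: (@le_trans _ _ (2 * cosh (scaled_resid u b lam (sgd u b lam (h_eps h) 0 s) i))).
    apply: le_trans (expR_normr_le_cosh _); rewrite ler_expR /scaled_resid normrM.
    by rewrite gtr0_norm // ler_pM2l // ltW.
  rewrite ler_pM2l // /potential (bigD1 i) //= lerDl.
  by apply: sumr_ge0 => j _; rewrite ltW ?cosh_gt0.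
apply: expected_potential.
rewrite /h /= (leNgt rad) rad_gt /=.
set y := _ / B%:R.
have := truncnS_gt y; rewrite /contraction => /ltW y_le.
have BR_gt0 : 0 < B%:R :> R by rewrite ltr0n.
have s_gt0 : 0 < Num.sqrt m%:R :> R by rewrite (lt_trans ltr01 sqrt_m_gt1).
(* The real count [y] makes contraction times [y] exactly [lam * rad]. *)
apply: (@le_trans _ _ (B%:R / (8 * m%:R * Num.sqrt m%:R) * y)).
  rewrite le_eqVlt; apply/orP; left; apply/eqP; rewrite /y -/lam.
  by field; rewrite !gt_eqF.
by rewrite ler_pM2l // divr_gt0 // !mulr_gt0.
Qed.

End SuccessProbability.

(** * The program *)

Definition batch_ctr : nat := 2.
Definition row_ctr : nat := 3.
Definition col_ctr : nat := 4.
Definition quad_arr : nat := 4.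
Definition scalar_arr : nat := 5.

Definition get_n : iexpr := IGet dim_arr (INat 0).
Definition get_m : iexpr := IGet dim_arr (INat 1).
Definition get_B : iexpr := IGet dim_arr (INat 2).
Definition ctr (x : nat) : iexpr := IGet x (INat 0).
Definition batch_index : iexpr := IGet batch_arr (ctr batch_ctr).
Definition get_lam : rexpr := RGet par_arr (INat 0).
Definition get_eps : rexpr := RGet par_arr (INat 1).
Definition get_sumsq : rexpr := RGet scalar_arr (INat 0).
Definition get_coef : rexpr := RGet scalar_arr (INat 1).
Definition get_weight : rexpr := RGet scalar_arr (INat 2).

Definition sinh_expr (x : rexpr) : rexpr :=
  RDiv (RSub (RExp x) (RExp (RSub (ROfNat (INat 0)) x))) (ROfNat (INat 2)).

Definition sinh_resid_expr (i : iexpr) : rexpr :=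
  sinh_expr (RMul get_lam (RSub (RGet quad_arr i) (RGet b_arr i))).

Definition sqr_expr (x : rexpr) : rexpr := RMul x x.

Definition A_entry : iexpr := IAdd (IMul (ctr row_ctr) get_n) (ctr col_ctr).
Definition u_entry (x : nat) : iexpr := IAdd (IMul batch_index get_n) (ctr x).

Definition rank1_entry_cmd : cmd :=
  RSet A_arr A_entry (RSub (RGet A_arr A_entry)
    (RMul get_weight (RMul (RGet u_arr (u_entry row_ctr)) (RGet u_arr (u_entry col_ctr))))).

Definition rank1_cmd : cmd :=
  For row_ctr get_n (For col_ctr get_n rank1_entry_cmd).

(** The old square leaves the running sum before [quad_arr] changes and the new one enters
    afterwards, so the sum of [m] squares is maintained in constant time. *)
Definition scalars_cmd : cmd :=
  Seq (RSet scalar_arr (INat 2)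
        (RMul get_coef (RMul get_lam (sinh_resid_expr batch_index))))
  (Seq (RSet scalar_arr (INat 0)
        (RSub get_sumsq (sqr_expr (sinh_resid_expr batch_index))))
  (Seq (RSet quad_arr batch_index (RSub (RGet quad_arr batch_index) get_weight))
       (RSet scalar_arr (INat 0)
        (RAdd get_sumsq (sqr_expr (sinh_resid_expr batch_index)))))).

(** Evaluated once per iteration: every sample must use the gradient norm at the start of the batch,
    although the running sum changes meanwhile. *)
Definition coef_cmd : cmd :=
  RSet scalar_arr (INat 1)
    (RMul (RDiv get_eps (RMul get_lam (RSqrt get_sumsq)))
          (RDiv (ROfNat get_m) (ROfNat get_B))).

Definition sample_cmd : cmd := Seq scalars_cmd rank1_cmd.

(* The Frobenius norm of the full gradient is too expensive to recompute in each
   iteration, so [quad_arr] keeps u_i^T A u_i and cell 0 of [scalar_arr] keeps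
   the sum over all i of sinh^2 (lam (u_i^T A u_i - b_i)). *)
Definition step_cmd : cmd := Seq coef_cmd (For batch_ctr get_B sample_cmd).

(** Zero-initialised memory already encodes the zero starting matrix and its quadratic forms; only
    the sum has to be computed. *)
Definition setup_cmd : cmd :=
  For batch_ctr get_m
    (RSet scalar_arr (INat 0)
       (RAdd get_sumsq (sqr_expr (sinh_resid_expr (ctr batch_ctr))))).

(** * Invariant and cost rule for loops *)

Section Loops.
Variable R : realType.
Implicit Types st s : state R.

Lemma exec_for (I : nat -> state R -> Prop) (K : nat) x e c st :
  I 0%N st ->
  (forall k s, (k < ieval st e)%N -> I k s ->
     I k.+1 (exec c (iset s x 0 k)).1 /\ ((exec c (iset s x 0 k)).2 <= K)%N) ->
  I (ieval st e) (exec (For x e c) st).1 /\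
  ((exec (For x e c) st).2 <= (icost e).+1 + ieval st e * K.+1)%N.
Proof.
move=> I0 IS.
pose body k acc : state R * nat :=
  let r := exec c (iset acc.1 x 0%N k) in (r.1, (acc.2 + r.2).+1).
have iter_body k : (k <= ieval st e)%N ->
    I k (iteri k body (st, (icost e).+1)).1 /\
    ((iteri k body (st, (icost e).+1)).2 <= (icost e).+1 + k * K.+1)%N.
  elim: k => [_|k IH k_le]; first by rewrite mul0n addn0.
  have [Ik cost_k] := IH (ltnW k_le); have [ISk cost_S] := IS _ _ k_le Ik.
  by split=> //=; lia.
exact: iter_body.
Qed.

End Loops.

(** * The rank-one update of the matrix *)

Section Rank1.
Variable R : realType.
Implicit Types st s : state R.

Definition rank1_frame st s : Prop :=
  (forall a j, a != row_ctr -> a != col_ctr -> imem s a j = imem st a j) /\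
  (forall a j, a != A_arr -> rmem s a j = rmem st a j).

Lemma flat_index_eq n p q p' q' : (q < n)%N -> (q' < n)%N ->
  (p * n + q == p' * n + q')%N = (p == p') && (q == q').
Proof.
move=> q_lt q'_lt; apply/eqP/andP => [e|[/eqP-> /eqP->] //].
have n_gt0 : (0 < n)%N by lia.
have /eqP := congr1 (modn^~ n) e; rewrite !modnMDl !modn_small // => ->.
have /eqP := congr1 (divn^~ n) e; rewrite !divnMDl // !divn_small // !addn0 => ->.
by [].
Qed.

Lemma exec_rank1 st :
  let n := imem st dim_arr 0 in
  let i := imem st batch_arr (imem st batch_ctr 0) in
  let r := exec rank1_cmd st in
  [/\ rank1_frame st r.1,
      forall p q, (p < n)%N -> (q < n)%N ->
        rmem r.1 A_arr (p * n + q) = rmem st A_arr (p * n + q) -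
          rmem st scalar_arr 2 *
            (rmem st u_arr (i * n + p) * rmem st u_arr (i * n + q))
    & (r.2 <= 3 + n * (4 + n * 50).+1)%N].
Proof.
move=> n i r.
pose new p q := rmem st A_arr (p * n + q) - rmem st scalar_arr 2 *
            (rmem st u_arr (i * n + p) * rmem st u_arr (i * n + q)).
pose I k s := rank1_frame st s /\ forall p q, (p < n)%N -> (q < n)%N ->
  rmem s A_arr (p * n + q) = if (p < k)%N then new p q else rmem st A_arr (p * n + q).
have [] := @exec_for R I (4 + n * 50) row_ctr get_n (For col_ctr get_n rank1_entry_cmd) st.
- by split.
- move=> k s k_lt [[fi fr] As].
  set s0 := iset s _ _ _.
  have n0 : ieval s0 get_n = n by rewrite /= /upd /= fi.
  rewrite /= -/n in k_lt.
  (* Inner invariant: rows before [k] are finished, and row [k] is updated in the columns before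
     [l]. *)
  pose J l t := [/\ rank1_frame st t, imem t row_ctr 0 = k &
    forall p q, (p < n)%N -> (q < n)%N ->
    rmem t A_arr (p * n + q) = if (p < k)%N || (p == k) && (q < l)%N
      then new p q else rmem st A_arr (p * n + q)].
  have [] := @exec_for R J 49 col_ctr get_n rank1_entry_cmd s0.
  + split=> //.
      split=> [a j a_row a_col|a j a_A]; last exact: fr.
      by rewrite /= /upd (negPf a_row) /= fi.
    by move=> p q p_lt q_lt; rewrite andbF orbF; exact: As.
  + rewrite n0 => l t l_lt [[ti tr] tk tA]; split; last by [].
    have ti_n : imem t dim_arr 0 = n by rewrite ti.
    split.
    * split=> [a j a_row a_col|a j a_A].
        by rewrite /= /upd (negPf a_col) /= ti.
      by rewrite /= /upd (negPf a_A) /= tr.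
    * by rewrite /= /upd /= tk.
    * move=> p q p_lt q_lt; rewrite /= /upd /= ti_n tk flat_index_eq //.
      have [-> /=|p_neq /=] := eqVneq p k; last by rewrite tA // (negPf p_neq).
      have [-> /=|q_neq /=] := eqVneq q l.
        by rewrite ltnn leqnn /= (tA k l) // !ltnn eqxx /= !tr // !ti.
      by rewrite tA // ltnn eqxx /= ltnS [in RHS]leq_eqVlt (negPf q_neq).
  rewrite n0; set t := exec _ _; move=> [tf _ tA] cost; split; last by rewrite (leq_trans cost).
  by split=> // p q p_lt q_lt; rewrite tA // q_lt andbT ltnS [in RHS]leq_eqVlt orbC.
move=> [rf rA] cost; split=> //.
  by move=> p q p_lt q_lt; rewrite rA // p_lt.
Qed.

End Rank1.

(** * Correctness and cost of one iteration *)

Section Program.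
Variables (R : realType) (m n : nat) (u : 'I_m -> 'cV[R]_n) (b : 'I_m -> R).
Variables (B : nat) (h : hyper R).
Hypothesis u_orthonormal : forall i j, dot (u i) (u j) = (i == j)%:R.
Implicit Types (st s : state R) (A : 'M[R]_n).

Let lam := h_lam h.
Let resids A : 'I_m -> R := scaled_resid u b lam A.

(** The last two clauses keep the cached quantities in step with [A]; the invariant also holds
    between samples of one batch. *)
Definition represents st A : Prop :=
  [/\ imem st dim_arr =1 nth 0%N [:: n; m; B],
      forall a j, (a < A_arr)%N -> rmem st a j = input_rmem u b h a j,
      forall p q : 'I_n, rmem st A_arr (p * n + q)%N = A p q,
      forall i : 'I_m, rmem st quad_arr i = quad (u i) A
    & rmem st scalar_arr 0 = \sum_i sinh (resids A i) ^+ 2].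

Lemma input_u (i : 'I_m) (p : 'I_n) : input_rmem u b h u_arr (i * n + p)%N = u i p 0.
Proof.
rewrite /input_rmem /= (bigD1 i) //= (big_pred1 p) => [|q]; last first.
  by rewrite flat_index_eq // eqxx.
rewrite big1 ?addr0 // => j ij; rewrite big_pred0 // => q.
by rewrite flat_index_eq // (inj_eq val_inj) (negPf ij).
Qed.

Lemma input_b (i : 'I_m) : input_rmem u b h b_arr i = b i.
Proof. by rewrite /input_rmem /= (big_pred1 i). Qed.

Lemma exec_scalars st (i := imem st batch_arr (imem st batch_ctr 0))
    (x := sinh (rmem st par_arr 0 * (rmem st quad_arr i - rmem st b_arr i)))
    (w := rmem st scalar_arr 1 * (rmem st par_arr 0 * x))
    (y := sinh (rmem st par_arr 0 * (rmem st quad_arr i - w - rmem st b_arr i)))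
    (r := exec scalars_cmd st) :
  [/\ imem r.1 = imem st,
      (forall a j, (a < quad_arr)%N -> rmem r.1 a j = rmem st a j),
      (forall j, rmem r.1 quad_arr j =
         if j == i then rmem st quad_arr i - w else rmem st quad_arr j)
    & [/\ rmem r.1 scalar_arr 0 = rmem st scalar_arr 0 - x * x + y * y,
          rmem r.1 scalar_arr 1 = rmem st scalar_arr 1,
          rmem r.1 scalar_arr 2 = w
        & (r.2 <= 300)%N]].
Proof.
split=> //.
- by move=> a j; rewrite /= /upd /=; case: a => [|[|[|[|]]]].
- move=> j; rewrite /r /= /upd /= /sinh -/i.
  by rewrite /w /x /sinh !sub0r; case: eqP => // ->.
split=> //.
- by rewrite /r /= /upd /= -/i !eqxx /= /y /w /x /sinh !sub0r.
- by rewrite /r /= /upd /= -/i /w /x /sinh !sub0r.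
Qed.

Lemma exec_seq c1 c2 st :
  exec (Seq c1 c2) st = ((exec c2 (exec c1 st).1).1,
    ((exec c1 st).2 + (exec c2 (exec c1 st).1).2)%N).
Proof. by []. Qed.

(** A multiple of [u i *m (u i)^T] changes only the quadratic form of [u i], so updating one cached
    form and one summand restores the invariant. *)
Lemma exec_sample st A (i : 'I_m) (r := exec sample_cmd st) :
  represents st A -> imem st batch_arr (imem st batch_ctr 0) = i ->
  [/\ represents r.1 (A - rmem st scalar_arr 1 *: grad_term lam (u i) (b i) A),
      rmem r.1 scalar_arr 1 = rmem st scalar_arr 1,
      imem r.1 batch_arr =1 imem st batch_arr
    & (r.2 <= 300 + (3 + n * (4 + n * 50).+1))%N].
Proof.
move=> [st_dim st_in st_A st_quad st_sum] st_i.
rewrite {}/r /sample_cmd exec_seq; move: (exec_scalars st); rewrite st_i.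
case: (exec scalars_cmd st) => s s_cost'; cbn [fst snd].
move=> [s_imem s_in s_quad [s_sum s_coef s_w s_cost]].
move: (exec_rank1 s); rewrite s_imem st_i (st_dim 0).
case: (exec rank1_cmd s) => t t_cost' /= [[t_imem t_frame] t_A t_cost].
have lamE : rmem st par_arr 0 = lam by rewrite st_in.
have bE j : rmem st b_arr (nat_of_ord j) = b j by rewrite st_in // input_b.
have residsE (j : 'I_m) :
    rmem st par_arr 0 * (rmem st quad_arr j - rmem st b_arr j) = resids A j.
  by rewrite lamE st_quad bE.
have wE : rmem st scalar_arr 1 * (rmem st par_arr 0 * sinh (resids A i))
    = rmem st scalar_arr 1 * (lam * sinh (resids A i)) by rewrite lamE.
rewrite residsE wE in s_sum s_quad s_w.
set c := rmem st scalar_arr 1 in s_sum s_quad s_w wE s_coef *.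
set w := c * _ in s_sum s_quad s_w wE.
have quadE' j : quad (u j) (A - c *: grad_term lam (u i) (b i) A)
    = quad (u j) A - w * (j == i)%:R.
  by rewrite quadB !quadZ quad_outer_orthonormal // mulrA.
split.
- split.
  + by move=> j; rewrite t_imem // s_imem.
  + by case=> [|[|[|]]] // j _; rewrite t_frame // s_in // st_in.
  + move=> p q; rewrite t_A // s_w !s_in // st_A !st_in // !input_u.
    by rewrite !mxE big_ord1 !mxE /w /resids /scaled_resid; ring.
  + move=> j; rewrite t_frame // s_quad quadE' (inj_eq val_inj).
    by case: eqP => [->|_]; rewrite ?mulr1 ?mulr0 ?subr0 st_quad.
  + rewrite t_frame // s_sum st_sum (bigD1 i) //= [RHS](bigD1 i) //=.
    rewrite /resids /scaled_resid !residE quadE' eqxx mulr1.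
    rewrite [X in _ = _ + X](eq_bigr (fun j => sinh (resids A j) ^+ 2)) => [|j ji]; last first.
      by rewrite /resids /scaled_resid !residE quadE' (negPf ji) mulr0 subr0.
    by rewrite lamE st_quad bE -/lam -residE -/(resids A i); ring.
- by rewrite t_frame.
- by move=> j; rewrite t_imem // s_imem.
- exact: leq_add.
Qed.

(* By orthogonality, processing one sample leaves the other residuals unchanged,
   so the samples of a batch may be processed one after the other. *)
Lemma exec_step st A (S : {set 'I_m}) (r := exec step_cmd (load_batch S st)) :
  0 < lam -> #|S| = B -> represents st A ->
  represents r.1 (sgd_step u b lam (h_eps h) A S) /\
  (r.2 <= 100 + B * (304 + n * (4 + n * 50).+1).+1)%N.
Proof.
move=> lam_gt0 cS [st_dim st_in st_A st_quad st_sum].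
rewrite {}/r /step_cmd exec_seq.
set st1 := (exec coef_cmd _).1.
set e := enum S.
have size_e : size e = B by rewrite -cardE.
pose c := h_eps h / frob (grad u b lam A) * (m%:R / B%:R).
pose partial k : 'M[R]_n :=
  A - c *: \sum_(i | i \in take k e) grad_term lam (u i) (b i) A.
have st1_dim : imem st1 dim_arr =1 nth 0%N [:: n; m; B] by move=> j; exact: st_dim.
have st1_coef : rmem st1 scalar_arr 1 = c.
  by rewrite /st1 /= /upd /= !st_dim st_sum !st_in //= /c frob_grad ?ltW.
have st1_rep : represents st1 A.
  split=> //.
    by case=> [|[|[|]]] // j _; exact: st_in.
have get_B_st1 : ieval st1 get_B = B by exact: st1_dim.
pose I k s := [/\ represents s (partial k), rmem s scalar_arr 1 = c
  & imem s batch_arr =1 nth 0%N (map val e)].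
have [] := @exec_for R I (300 + (3 + n * (4 + n * 50).+1)) batch_ctr get_B sample_cmd st1.
- split=> //; rewrite /partial take0 big_pred0 // scaler0 subr0 //.
- rewrite get_B_st1 => k s k_lt [s_rep s_coef s_batch].
  set s0 := iset s _ _ _.
  have i0 : 'I_m by move: k_lt; rewrite -size_e; case: (e) => [|i ?].
  pose i := nth i0 e k.
  have k_e : (k < size e)%N by rewrite size_e.
  have s0_i : imem s0 batch_arr (imem s0 batch_ctr 0) = i.
    by rewrite /= /upd /= s_batch (nth_map i0).
  have s0_rep : represents s0 (partial k).
    by case: s_rep => ? ? ? ? ?; split.
  (* A repeated sample would see its own earlier update; [enum S] has no duplicates. *)
  have i_new : i \notin take k e.
    have := enum_uniq S; rewrite -/e -{1}(cat_take_drop k e) cat_uniq => /and3P[_ /hasPn h_disj _].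
    by apply: h_disj; rewrite (drop_nth i0 k_e) mem_head.
  have partialS : partial k.+1 = partial k - c *: grad_term lam (u i) (b i) (partial k).
    have -> : grad_term lam (u i) (b i) (partial k) = grad_term lam (u i) (b i) A.
      rewrite /grad_term !residE quadB quadZ.
      by rewrite (quad_orthonormal_sum _ (mem (take k e))) //= (negPf i_new) mul0r mulr0 subr0.
    rewrite /partial (take_nth i0 k_e) -/i -addrA -opprD -scalerDr; congr (_ - _ *: _).
    rewrite (bigD1 i) ?mem_rcons ?mem_head //= addrC; congr (_ + _).
    apply: eq_bigl => j; rewrite mem_rcons inE; case: eqP => [->|_] /=.
      by rewrite (negPf i_new).
    by rewrite andbT.
  have := exec_sample s0_rep s0_i.
  rewrite (_ : rmem s0 scalar_arr 1 = c); last exact: s_coef.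
  case: (exec sample_cmd s0) => t t_cost'; cbn [fst snd].
  move=> [t_rep t_coef t_batch t_cost]; split; last exact: t_cost.
  split; [|exact: t_coef|].
  + by rewrite partialS; exact: t_rep.
  + by move=> j; rewrite t_batch; exact: s_batch.
rewrite get_B_st1; case: (exec (For _ _ _) _) => t t_cost'; cbn [fst snd].
move=> [t_rep _ _] t_cost; split.
  rewrite (_ : sgd_step _ _ _ _ _ _ = partial B) // /sgd_step /partial /batch_grad.
  rewrite scalerA cS -/c; congr (_ - _ *: _); apply: eq_bigl => i.
  by rewrite take_oversize ?size_e // mem_enum.
by apply: leq_trans (leq_add (leqnn _) t_cost) _; rewrite /=; lia.
Qed.

End Program.

(** * Setup and whole runs *)

Section RunProgram.
Variables (R : realType) (m n : nat) (u : 'I_m -> 'cV[R]_n) (b : 'I_m -> R).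
Variables (B : nat) (h : hyper R).
Hypothesis u_orthonormal : forall i j, dot (u i) (u j) = (i == j)%:R.
Hypotheses (lam_gt0 : 0 < h_lam h) (tau0 : h_tau h = 0).

Lemma exec_setup :
  represents u b B h (exec setup_cmd (input u b B h)).1 (h_tau h)%:M /\
  ((exec setup_cmd (input u b B h)).2 <= 3 + m * 101)%N.
Proof.
have tau_mx : (h_tau h)%:M = 0 :> 'M[R]_n by rewrite tau0 raddf0.
pose F (i : 'I_m) := sinh (scaled_resid u b (h_lam h) (h_tau h)%:M i) ^+ 2.
pose I k (s : state R) := [/\ imem s dim_arr =1 nth 0%N [:: n; m; B],
  (forall a j, (a < scalar_arr)%N -> rmem s a j = input_rmem u b h a j)
  & rmem s scalar_arr 0 = \sum_(i < m | (i < k)%N) F i].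
have := @exec_for R I 100 batch_ctr get_m
  (RSet scalar_arr (INat 0)
       (RAdd get_sumsq (sqr_expr (sinh_resid_expr (ctr batch_ctr)))))
  (input u b B h).
rewrite -/setup_cmd (_ : ieval _ get_m = m) //.
case: (exec setup_cmd _) => t t_cost; cbn [fst snd]; case.
- by split=> //; rewrite big_pred0.
- move=> k s k_lt [s_dim s_in s_sum]; split; last by [].
  split; first exact: s_dim.
  + by case=> [|[|[|[|[|]]]]] // j _; exact: s_in.
  pose i := Ordinal k_lt.
  rewrite (bigD1 i) //= [X in _ = _ + X](eq_bigl (fun j : 'I_m => (j < k)%N)); last first.
    by move=> j; rewrite -val_eqE /= ltnS ltn_neqAle andbC.
  rewrite /upd /= s_sum addrC; congr (_ + _).
  rewrite !s_in // -[k]/(val i) input_b /F tau_mx /scaled_resid residE quad0.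
  by rewrite /sinh !sub0r expr2.
- move=> [t_dim t_in t_sum] cost; split=> //; split=> //.
  + by case=> [|[|[|]]] // j _; exact: t_in.
  + by move=> p q; rewrite t_in // tau_mx mxE.
  + by move=> i; rewrite t_in // tau_mx quad0.
  + by rewrite t_sum; apply: eq_bigl => i; rewrite ltn_ord.
Qed.

Lemma represents_read_A st A : represents u b B h st A -> read_A n st = A.
Proof. by case=> _ _ st_A _ _; apply/matrixP => p q; rewrite mxE st_A. Qed.

Lemma represents_run s : all (fun S : {set 'I_m} => #|S| == B) s ->
  represents u b B h (run u b setup_cmd step_cmd B h s)
    (sgd u b (h_lam h) (h_eps h) (h_tau h) s).
Proof.
have [+ _] := exec_setup; rewrite /run /sgd.
elim: s (exec setup_cmd _).1 (h_tau h)%:M => [|S s IH] st A //= st_rep /andP[/eqP cS s_B].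
by apply: IH => //; have [] := exec_step u_orthonormal lam_gt0 cS st_rep.
Qed.

End RunProgram.

Theorem theorem6p1 (R : realType) (k : nat) :
  exists (setup step : cmd) (par : nat -> nat -> nat -> R -> R -> hyper R)
         (P : {poly R}) (C : nat),
  forall (m n : nat) (u : 'I_m -> 'cV[R]_n) (b : 'I_m -> R) (rad : R) (B : nat)
         (delta : R),
    (0 < m)%N -> (0 < n)%N ->
    (forall i, enorm (u i) = 1) ->
    (forall i j, i != j -> dot (u i) (u j) = 0) ->
    (forall i, `|b i| <= rad) ->
    (0 < B < m)%N ->
    0 < delta < 1 ->
    let h := par m n B rad delta in
    let T := h_iters h in
    let f := m%:R `^ (3 / 2) * B%:R^-1 * rad * delta^-1 in
    [/\ 0 < h_lam h /\ 0 < h_eps h,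
        T%:R <= f * P.[ln f],
        ((exec setup (input u b B h)).2 <= C * (m * n ^ 2))%N,
        (forall s : seq {set 'I_m},
           (size s <= T)%N -> all (fun S : {set 'I_m} => #|S| == B) s ->
           read_A n (run u b setup step B h s)
             = sgd u b (h_lam h) (h_eps h) (h_tau h) s)
        /\ (forall (s : seq {set 'I_m}) (S : {set 'I_m}),
           (size s < T)%N -> all (fun S' : {set 'I_m} => #|S'| == B) s ->
           #|S| = B ->
           ((iteration step (run u b setup step B h s) S).2 <= C * (B * n ^ 2))%N)
      & 1 - m%:R ^- k <=
        batch_prob R B T (fun s : seq {set 'I_m} =>
          [forall i, `|resid (u i) (b i) (read_A n (run u b setup step B h s))|
                       <= delta])].
Proof.
(* An iteration costs at most [100 + B * (306 + 5 * n + 50 * n ^ 2)], hence at most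
   [461 * B * n ^ 2] as [n] and [B] are positive; 500 also covers the setup. *)
exists setup_cmd, step_cmd, (tuned_hyper k), (polylog R k), 500%N.
move=> m n u b rad B delta m_gt0 n_gt0 u_unit u_orth b_le B_bounds /andP[delta_gt0 _] h T f.
have [B_gt0 B_lt] := andP B_bounds.
have u_orthonormal i j : dot (u i) (u j) = (i == j)%:R.
  have [<-|ij] := eqVneq i j; last exact: u_orth.
  have dot_ge0 : 0 <= dot (u i) (u i).
    by apply: sumr_ge0 => p _; rewrite -expr2 sqr_ge0.
  by rewrite -(sqr_sqrtr dot_ge0) -/(enorm (u i)) u_unit expr1n.
have lam_gt0 : 0 < h_lam h.
  by apply: tuned_lam_gt0 => //; exact: leq_ltn_trans B_lt.
have n2_gt0 : (0 < n ^ 2)%N by rewrite expn_gt0 n_gt0.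
have rad_ge0 : 0 <= rad := le_trans (normr_ge0 _) (b_le (Ordinal m_gt0)).
have rep s : all _ s -> _ := @represents_run R m n u b B h u_orthonormal lam_gt0 erefl s.
split.
- split=> //; rewrite /h /= divr_gt0 ?ltr0n //.
  by apply: mulr_gt0 lam_gt0; rewrite mulr_gt0 ?ltr0n.
- exact: tuned_iters_le.
- have [_ cost] := @exec_setup R m n u b B h erefl.
  apply: leq_trans cost _; nia.
- split=> [s _ s_B|s S _ s_B cS]; first exact: represents_read_A (rep s s_B).
  have [_ cost] := exec_step u_orthonormal lam_gt0 cS (rep s s_B).
  rewrite /iteration; cbn [fst snd]; rewrite cS.
  apply: leq_trans (leq_add (leqnn _) cost) _; nia.
- have := sgd_success_prob k u_orthonormal b_le B_gt0 B_lt delta_gt0.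
  move=> /le_trans; apply; rewrite /batch_prob le_eqVlt; apply/orP; left; apply/eqP.
  (* On batches of size [B] the matrix in memory is the abstract iterate, so both events contain the
     same sequences. *)
  congr (_%:R / _); apply: eq_card => s; rewrite !inE; apply: andb_id2l => s_B.
  rewrite /sgd_success; apply: eq_forallb => i.
  by rewrite (represents_read_A (rep s s_B)).
Qed.
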